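(* Let $\mathsf k$ be any field (not necessarily infinite), $S=\mathsf k[x,y,z]$, and let $R=S/I$ be a standard graded Artinian Gorenstein $\mathsf k$-algebra of codimension three such that $\mathrm{NS}_R\ge 2$. Let $s$ be the largest degree in which the $h$-vector of $R$ attains its maximum. Then $\gcd(I_{\le s})=1$, where $I_{\le s}$ is the set of all elements of $I$ of degree at most $s$.
   Context: $S=\mathsf k[x,y,z]$ has the standard grading, $\mathfrak m=\langle x,y,z\rangle$, and $I\subseteq\mathfrak m$ is a homogeneous ideal; $M_i$ denotes the degree $i$ component of a graded object $M$. $R=S/I$ is Artinian if $\dim_{\mathsf k}R<\infty$; its socle degree is the largest $d$ with $R_d\ne 0$, and its $h$-vector is $(h_0,\dots,h_d)$ with $h_i=\dim_{\mathsf k}R_i$. The codimension of $R$ is $h_1$ (so codimension three means $I\subseteq\mathfrak m^2$). $R$ is Gorenstein if its socle $\operatorname{soc}(R)=\{a\in R\mid \mathfrak m a=0\}$ has $\mathsf k$-dimension $1$. Let $S_R=\max_i h_i$, $t=\min\{i\mid h_i=S_R\}$, $s=\max\{i\mid h_i=S_R\}$; the number of peaks is $\mathrm{NS}_R=s-t+1$. The gcd of a set of polynomials is taken in the UFD $S$ and is defined up to a nonzero scalar. *)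

(* Defs.v *)
From HB Require Import structures.
From mathcomp Require Import all_boot all_order all_algebra ring_quotient.
From mathcomp Require Export mpoly.

Set Implicit Arguments.
Unset Strict Implicit.
Unset Printing Implicit Defensive.

Import GRing.Theory.
Local Open Scope ring_scope.
Local Open Scope quotient_scope.

(* The library makes {ideal_quot I} a commutative ring; this adds the scalar
   action of k coming from k -> k[x_1..x_n] -> k[x_1..x_n]/I. *)
Section QuotientLmodule.
Variables (k : fieldType) (n : nat) (I : idealr {mpoly k[n]}).
Implicit Types (a b : k) (u v : {ideal_quot I}).

Definition quot_scale a u : {ideal_quot I} := \pi_{ideal_quot I} (a%:MP) * u.

Lemma quot_scaleA a b u : quot_scale a (quot_scale b u) = quot_scale (a * b) u.
Proof. by rewrite /quot_scale mulrA -rmorphM -mpolyCM. Qed.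

Lemma quot_scale1 : left_id 1 quot_scale.
Proof. by move=> u; rewrite /quot_scale mpolyC1 rmorph1 mul1r. Qed.

Lemma quot_scaleDr : right_distributive quot_scale +%R.
Proof. by move=> a u v; rewrite /quot_scale mulrDr. Qed.

Lemma quot_scaleDl u : {morph quot_scale^~ u : a b / a + b}.
Proof. by move=> a b; rewrite /quot_scale mpolyCD rmorphD mulrDl. Qed.

HB.instance Definition _ := GRing.Zmodule_isLmodule.Build k {ideal_quot I}
  quot_scaleA quot_scale1 quot_scaleDr quot_scaleDl.

Lemma pi_scale a (f : {mpoly k[n]}) :
  \pi_{ideal_quot I} (a *: f) = a *: \pi_{ideal_quot I} f.
Proof. by rewrite -mul_mpolyC rmorphM. Qed.
End QuotientLmodule.

(* W is meant to be a k-subspace of V; W has dimension m. *)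
Definition has_dim (k : fieldType) (V : lmodType k) (W : V -> Prop) (m : nat) :=
  exists b : 'I_m -> V,
    [/\ forall i, W (b i),
        forall c : 'I_m -> k, \sum_i c i *: b i = 0 -> forall i, c i = 0
      & forall v, W v -> exists c : 'I_m -> k, v = \sum_i c i *: b i].

Section GradedQuotient.
Variables (k : fieldType) (n : nat) (I : idealr {mpoly k[n]}).

Definition irrelevant (f : {mpoly k[n]}) :=
  exists q : 'I_n -> {mpoly k[n]}, f = \sum_i q i * 'X_i.

Definition homogeneous_ideal :=
  forall (d : nat) (f : {mpoly k[n]}), f \in I -> pihomog mdeg d f \in I.

Definition quot_degree (i : nat) (u : {ideal_quot I}) :=
  exists2 f : {mpoly k[n]}, f \is i.-homog & u = \pi_{ideal_quot I} f.

Definition artinian_quot :=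
  exists m, has_dim (fun _ : {ideal_quot I} => True) m.

Definition socle (u : {ideal_quot I}) :=
  forall f, irrelevant f -> \pi_{ideal_quot I} f * u = 0.

Definition gorenstein_quot := has_dim socle 1.

(* h = [:: h_0; ...; h_d] with d the socle degree: the last entry is nonzero
   and all components of degree >= size h vanish. *)
Definition is_hvector (h : seq nat) :=
  last 0%N h != 0%N /\ forall i, has_dim (quot_degree i) (nth 0%N h i).

(* msize f is deg f + 1, and 0 for f = 0. *)
Definition ideal_le (s : nat) (f : {mpoly k[n]}) :=
  f \in I /\ (msize f <= s.+1)%N.
End GradedQuotient.

Definition peak_value (h : seq nat) : nat := \max_(x <- h) x.

Definition first_peak (h : seq nat) : nat := index (peak_value h) h.

Definition last_peak (h : seq nat) : nat :=
  \max_(i < size h | nth 0%N h i == peak_value h) i.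

Definition num_peaks (h : seq nat) : nat :=
  (last_peak h - first_peak h + 1)%N.

Definition divides (A : comNzRingType) (f g : A) := exists q, g = q * f.

Definition is_gcd (A : comNzRingType) (P : A -> Prop) (g : A) :=
  (forall f, P f -> divides g f) /\
  (forall e, (forall f, P f -> divides e f) -> divides e g).

(* Main.v *)
From HB Require Import structures.
Require Import Defs.
From mathcomp Require Import all_boot all_order all_algebra ring_quotient.
From mathcomp Require Import zify.

(** Write S = k[x,y,z], let d be the socle degree of R = S/I and let s be the
    last peak of h.  Since R is Gorenstein, R_d is a line, and a linear form
    phi : S_d -> R_d = k makes the pairings R_i x R_(d-i) -> k perfect
    ([socle_functional]).  So everything can be read off the catalecticant
    matrices Cat_f(i,j), with entries phi(f m m') for monomials m, m' of
    degrees i and j: the degree i part of I is the kernel of Cat_1(i,d-i), and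
    h_i is its rank.  Transposing gives h_i = h_(d-i).  Hence t := d - s lies
    weakly before the first peak, and t < s.

    Let F be a form of degree e dividing the elements of I of degree at most s;
    the top form of any common divisor is one ([homog_top_factor]).  For i <= s
    the kernel of Cat_1(i,d-i) then consists of multiples of F, and counting
    dimensions gives
      dim S_i - dim S_(i-e) = rank Cat_1(i,d-i) - rank Cat_F(i-e,d-i)
    ([rank_common_factor]).  For i = s and i = t the ranks of Cat_1 agree, so
      (dim S_s - dim S_(s-e)) - (dim S_t - dim S_(t-e))
        = rank Cat_F(t-e,s) - rank Cat_F(s-e,t).
    The left side is positive as soon as e > 0, because i |-> dim S_i is
    strictly convex.  The right side is never positive: both ranks are
    values, at t - e and at t, of the Hilbert function of S/(I:F), which is zero
    or Gorenstein of socle degree d - e; the degree t is at least as close to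
    (d-e)/2 as t - e is, and Gorenstein Hilbert functions in three variables
    are unimodal.  So e = 0.

    Unimodality ([cat_rank_unimodal]) is proved by induction on the socle
    degree, over any field.  Comparing an algebra B = S/Ann(f phi) with the
    algebra S/Ann(x f phi), which is zero or has socle degree one less, leaves
    the Hilbert function c of B/xB, a quotient of k[y,z].  The increment of the
    Hilbert function of B at degree i+1 is an increment of the smaller algebra
    plus c_(i+1) - c_i; by symmetry it is also an increment of the smaller
    algebra plus c_j - c_(j+1), where i + j + 1 is the socle degree of B and
    i < j.
    Now c grows as long as the ideal of B/xB in k[y,z] is zero, and does not
    grow afterwards, so in each case one of the two expressions is nonnegative.
    *)

Set Implicit Arguments.
Unset Strict Implicit.
Unset Printing Implicit Defensive.

Import GRing.Theory.
Local Open Scope ring_scope.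
Local Open Scope quotient_scope.

(** * Forms in coordinates and catalecticant matrices *)
Section Coordinates.
Variables (k : fieldType) (n : nat).
Implicit Types (f g p : {mpoly k[n.+1]}) (m : 'X_{1..n.+1}) (i j l e : nat).

Definition form_dim i := 'C(i + n, i).

Definition monomials i : seq 'X_{1..n.+1} :=
  [seq s2m t | t : i.-tuple 'I_n.+1 <- enum (mpoly.basis n.+1 i)].

Definition mon i (a : 'I_(form_dim i)) : 'X_{1..n.+1} :=
  nth 0%MM (monomials i) a.

Lemma size_monomials i : size (monomials i) = form_dim i.
Proof. exact: mpoly.size_basis. Qed.

Lemma mdeg_mon i (a : 'I_(form_dim i)) : mdeg (mon a) = i.
Proof. by apply/eqP; rewrite basis_cover mem_nth // size_monomials. Qed.

Lemma mon_inj i : injective (@mon i).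
Proof.
move=> a b /eqP; rewrite nth_uniq ?size_monomials ?mpoly.uniq_basis //.
by move/eqP/val_inj.
Qed.

Lemma mon_surj i m : mdeg m = i -> exists a : 'I_(form_dim i), m = mon a.
Proof.
move/eqP; rewrite basis_cover => m_in.
have lt_m : (index m (monomials i) < form_dim i)%N.
  by rewrite -size_monomials index_mem.
by exists (Ordinal lt_m); rewrite /mon nth_index.
Qed.

Lemma Xmon_homog i (a : 'I_(form_dim i)) :
  ('X_[mon a] : {mpoly k[n.+1]}) \is i.-homog.
Proof. by rewrite dhomogX; apply/eqP/mdeg_mon. Qed.

Lemma X_homog (l : 'I_n.+1) : ('X_l : {mpoly k[n.+1]}) \is 1.-homog.
Proof. by rewrite dhomogX; apply/eqP/mdeg1. Qed.

Lemma XM_homog (l : 'I_n.+1) i p : p \is i.-homog -> 'X_l * p \is i.+1.-homog.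
Proof. exact: (dhomogM (X_homog l)). Qed.

Definition coords i p : 'rV[k]_(form_dim i) := \row_a p@_(mon a).

Definition form_of i (v : 'rV[k]_(form_dim i)) : {mpoly k[n.+1]} :=
  \sum_a v 0 a *: 'X_[mon a].

Lemma form_of_homog i (v : 'rV[k]_(form_dim i)) : form_of v \is i.-homog.
Proof.
by rewrite rpred_sum // => a _; rewrite rpredZ ?Xmon_homog.
Qed.

Lemma form_ofK i : cancel (@form_of i) (coords i).
Proof.
move=> v; apply/rowP=> a; rewrite mxE raddf_sum /= (bigD1 a) //=.
rewrite mcoeffZ mcoeffX eqxx mulr1 big1 ?addr0 // => b ne_ba.
by rewrite mcoeffZ mcoeffX (inj_eq (@mon_inj i)) (negbTE ne_ba) mulr0.
Qed.

Lemma coordsK i p : p \is i.-homog -> form_of (coords i p) = p.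
Proof.
move=> hom_p; apply/mpolyP=> m.
have [/mon_surj[a ->]|ne_m] := eqVneq (mdeg m) i; last first.
  by rewrite (dhomog_nemf_coeff hom_p) // (dhomog_nemf_coeff (form_of_homog _)).
by have /rowP/(_ a) := form_ofK (coords i p); rewrite !mxE.
Qed.

Lemma coords_is_linear i : linear (coords i).
Proof. by move=> c p q; apply/rowP=> a; rewrite !mxE mcoeffD mcoeffZ. Qed.

HB.instance Definition _ i :=
  GRing.isLinear.Build k {mpoly k[n.+1]} 'rV[k]_(form_dim i) _ (coords i)
    (@coords_is_linear i).

Lemma coords_mulmx i j p (T : {mpoly k[n.+1]} -> 'rV[k]_j) :
  linear T -> p \is i.-homog ->
  coords i p *m (\matrix_(a < form_dim i) T 'X_[mon a]) = T p.
Proof.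
move=> linT hom_p.
pose lT := GRing.isLinear.Build k {mpoly k[n.+1]} 'rV[k]_j _ T linT.
pose T' : {linear {mpoly k[n.+1]} -> 'rV[k]_j} := HB.pack T lT.
rewrite -[RHS]/(T' p) -{2}(coordsK hom_p) linear_sum mulmx_sum_row.
by apply: eq_bigr => a _; rewrite linearZ rowK.
Qed.

(** Multiplication by g from forms of degree i to forms of degree l, acting on
    row vectors; the degree l is a free parameter so that no cast is needed
    when it is only provably the sum of i and the degree of g. *)
Definition mult_mx g i l : 'M[k]_(form_dim i, form_dim l) :=
  \matrix_a coords l (g * 'X_[mon a]).

Lemma coords_mult g i l p :
  p \is i.-homog -> coords i p *m mult_mx g i l = coords l (g * p).
Proof.
apply: (coords_mulmx (T := fun q => coords l (g * q))) => c q r.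
by rewrite mulrDr -scalerAr linearP.
Qed.

Lemma mult_mx_free g e i l : g != 0 -> g \is e.-homog -> l = (e + i)%N ->
  row_free (mult_mx g i l).
Proof.
move=> nz_g hom_g ->; apply/inj_row_free => v.
rewrite -[v]form_ofK coords_mult ?form_of_homog // => eq0.
have : g * form_of v == 0.
  rewrite -[g * _](@coordsK (e + i)) ?dhomogM ?form_of_homog // eq0.
  by rewrite -(linear0 (coords (e + i))) coordsK ?dhomog0.
by rewrite mulf_eq0 (negbTE nz_g) => /eqP->; rewrite linear0.
Qed.

Variable phi : {scalar {mpoly k[n.+1]}}.

(** The pairing of S_i and S_j through the functional phi(f * _).  Keeping phi
    fixed and moving f lets an induction replace f by its multiples. *)
Definition cat_mx f i j : 'M[k]_(form_dim i, form_dim j) :=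
  \matrix_(a, b) phi (f * 'X_[mon a] * 'X_[mon b]).

Lemma tr_cat_mx f i j : (cat_mx f i j)^T = cat_mx f j i.
Proof. by apply/matrixP=> a b; rewrite !mxE mulrAC. Qed.

Lemma coords_cat f i j p : p \is i.-homog ->
  coords i p *m cat_mx f i j = \row_b phi (f * p * 'X_[mon b]).
Proof.
have -> : cat_mx f i j =
    \matrix_a (fun q => \row_b phi (f * q * 'X_[mon b])) 'X_[mon a].
  by apply/matrixP=> a b; rewrite !mxE.
apply: (coords_mulmx (T := fun q => \row_b phi (f * q * 'X_[mon b]))) => c q r.
apply/rowP=> b.
by rewrite !mxE mulrDr mulrDl -scalerAr -scalerAl linearP.
Qed.

(** Row relations of Cat_(f g) are the relations of Cat_f among multiples of g;
    this is the passage from an annihilator ideal J to the quotient J : g. *)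
Lemma mult_cat_mx f g e i l j : g \is e.-homog -> l = (e + i)%N ->
  mult_mx g i l *m cat_mx f l j = cat_mx (f * g) i j.
Proof.
move=> hom_g ->; apply/row_matrixP=> a; rewrite row_mul rowK coords_cat.
  by apply/rowP=> b; rewrite !mxE mulrA.
by rewrite dhomogM ?Xmon_homog.
Qed.

Lemma cat_mult_mx f g e i j l : g \is e.-homog -> l = (e + j)%N ->
  cat_mx f i l *m (mult_mx g j l)^T = cat_mx (f * g) i j.
Proof.
move=> hom_g def_l.
by rewrite -tr_cat_mx -trmx_mul (mult_cat_mx _ _ hom_g def_l) tr_cat_mx.
Qed.

Definition cat_rank f i j := \rank (cat_mx f i j).

(** The symmetry of Gorenstein Hilbert functions. *)
Lemma cat_rankC f i j : cat_rank f i j = cat_rank f j i.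
Proof. by rewrite /cat_rank -tr_cat_mx mxrank_tr. Qed.

End Coordinates.

(** * Unimodality in three variables *)
Lemma form_dim3 i : (2 * form_dim 2 i = i.+2 * i.+1)%N.
Proof.
rewrite /form_dim -bin_sub ?leq_addr // addKn addn2.
by rewrite -(mul_bin_diag i.+2 1) bin1.
Qed.

Section Unimodality.
Variables (k : fieldType) (phi : {scalar {mpoly k[3]}}).
Implicit Types (f : {mpoly k[3]}) (m : 'X_{1..3}) (i j N : nat).

Notation x := ('X_0 : {mpoly k[3]}).
Notation y := ('X_1 : {mpoly k[3]}).
Notation z := ('X_2%:R : {mpoly k[3]}).
Notation cat_mx := (cat_mx phi).
Notation cat_rank := (cat_rank phi).

Lemma X_neq0 l : ('X_l : {mpoly k[3]}) != 0.
Proof. by rewrite -msize_poly_eq0 msizeX. Qed.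

Lemma mdeg3 m : mdeg m = (m 0%R + m 1%R + m 2%:R%R)%N.
Proof.
rewrite mdegE !big_ord_recr big_ord0 /= add0n.
by congr (_ + _ + _)%N; congr (m _); apply/val_inj.
Qed.

(** Setting x = 0, y = 1, z = T identifies a form of degree i modulo x with a
    polynomial in T of degree at most i; its coefficients are stored in a row
    of a length N common to all degrees.  Multiplication by y then becomes the
    identity, and multiplication by z becomes the shift below. *)
Definition restr_mx N i : 'M[k]_(form_dim 2 i, N) :=
  \matrix_(a, b) ((mon a 0 == 0%N) && (mon a 2%:R == b))%:R.

Definition shift N : 'M[k]_N := \matrix_(a, b) (a.+1 == b :> nat)%:R.

Lemma coordsX_restr N i m : mdeg m = i ->
  coords i 'X_[m] *m restr_mx N i = \row_b ((m 0 == 0%N) && (m 2%:R == b))%:R.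
Proof.
case/mon_surj=> a ->; apply/rowP=> b; rewrite !mxE (bigD1 a) //= !mxE.
rewrite mcoeffX eqxx mul1r big1 ?addr0 // => c ne_ca.
by rewrite !mxE mcoeffX (inj_eq (@mon_inj _ _)) eq_sym (negbTE ne_ca) mul0r.
Qed.

Lemma row_mult_restr N i l (a : 'I_(form_dim 2 i)) (m := (U_(l) + mon a)%MM) :
  row a (mult_mx 'X_l i i.+1 *m restr_mx N i.+1) =
  \row_b ((m 0 == 0%N) && (m 2%:R == b))%:R.
Proof.
by rewrite row_mul rowK -mpolyXD coordsX_restr // mdegD mdeg1 mdeg_mon.
Qed.

Lemma mult_x00 : mult_mx x 0 0 = 0.
Proof.
apply/matrixP=> a b; rewrite !mxE -mpolyXD mcoeffX.
by case: eqP => // /(congr1 mdeg); rewrite mdegD mdeg1 !mdeg_mon.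
Qed.

Lemma mult_x_restr N i : mult_mx x i.-1 i *m restr_mx N i = 0.
Proof.
case: i => [|i] /=; first by rewrite mult_x00 mul0mx.
apply/row_matrixP=> a.
by rewrite row_mult_restr row0; apply/rowP=> b; rewrite !mxE mnmDE mnm1E.
Qed.

Lemma mult_y_restr N i : mult_mx y i i.+1 *m restr_mx N i.+1 = restr_mx N i.
Proof.
apply/row_matrixP=> a; rewrite row_mult_restr.
by apply/rowP=> b; rewrite !mxE !mnmDE !mnm1E.
Qed.

Lemma mult_z_restr N i :
  mult_mx z i i.+1 *m restr_mx N i.+1 = restr_mx N i *m shift N.
Proof.
apply/row_matrixP=> a; rewrite row_mult_restr.
apply/rowP=> b; rewrite !mxE !mnmDE !mnm1E /= add0n add1n.
have [m2b|ne_m2b] := eqVneq (mon a 2%:R%R).+1 b; last first.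
  rewrite andbF big1 // => c _; rewrite !mxE.
  have [<-|_] := eqVneq (mon a 2%:R) c; last by rewrite andbF mul0r.
  by rewrite (negbTE ne_m2b) mulr0.
have lt_m2 : (mon a 2%:R%R < N)%N.
  by rewrite (leq_ltn_trans _ (ltn_ord b)) // -m2b.
rewrite (bigD1 (Ordinal lt_m2)) //= !mxE /= m2b !eqxx !andbT mulr1.
rewrite big1 ?addr0 //.
move=> c ne_c; rewrite !mxE -m2b eqSS [(c : nat) == _](_ : _ = false) ?mulr0 //.
by apply/negbTE.
Qed.

(** The shift is injective on polynomials of degree at most i, the transposed
    shift being its left inverse there: nothing is pushed out of a row of
    length N > i + 1. *)
Lemma restr_mx_shiftK N i : (i.+1 < N)%N ->
  restr_mx N i *m shift N *m (shift N)^T = restr_mx N i.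
Proof.
move=> lt_iN; rewrite -mulmxA; apply/matrixP=> a b; rewrite mxE.
have le_m2 : (mon a 2%:R%R <= i)%N by have := mdeg_mon a; rewrite mdeg3; lia.
have lt_m2 : (mon a 2%:R%R < N)%N by lia.
have lt_m2' : ((mon a 2%:R%R).+1 < N)%N by lia.
rewrite (bigD1 (Ordinal lt_m2)) //= big1 => [|c ne_c]; last first.
  rewrite !mxE [_ == (c : nat)](_ : _ = false) ?andbF ?mul0r //.
  by apply/negbTE; rewrite eq_sym.
rewrite !mxE eqxx andbT addr0 (bigD1 (Ordinal lt_m2')) //= !mxE eqxx mul1r /=.
rewrite big1 ?addr0 => [|c ne_c]; last first.
  rewrite !mxE /= [_ == (c : nat)](_ : _ = false) ?mul0r //.
  by apply/negbTE; rewrite eq_sym.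
by rewrite eqSS [(b : nat) == _]eq_sym; case: (_ == 0%N); rewrite ?mul1r ?mul0r.
Qed.

(** For i = 0 the matrix on the right is the zero matrix ([mult_x00]), since
    then i.-1 = i; this matches the fact that no nonzero constant is a multiple
    of x. *)
Lemma ker_restr N i : (i < N)%N ->
  (kermx (restr_mx N i) <= mult_mx x i.-1 i)%MS.
Proof.
move=> lt_iN; apply/rV_subP=> v /sub_kermxP vK0.
rewrite -[v]form_ofK linear_sum summx_sub // => a _.
rewrite linearZ /=.
have deg_a := mdeg_mon a.
have [a0|a_n0] := eqVneq (mon a 0) 0%N.
  suff -> : v 0 a = 0 by rewrite scale0r sub0mx.
  have lt_m2 : (mon a 2%:R%R < N)%N.
    by move: deg_a; rewrite mdeg3; lia.
  move/rowP/(_ (Ordinal lt_m2)): vK0; rewrite !mxE (bigD1 a) //= !mxE /=.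
  rewrite a0 !eqxx mulr1 big1 ?addr0 // => c; rewrite !mxE /=.
  case: andP => [[/eqP c0 /eqP c2]|]; rewrite ?mulr0 // => /eqP[].
  have c1 : mon c 1 = mon a 1.
    by have := mdeg_mon c; move: deg_a; rewrite !mdeg3 c0 c2 a0; lia.
  apply: mon_inj; apply/mnmP; case=> [[|[|[|//]]] l3].
  - by move: (etrans c0 (esym a0)); congr (mon c _ = mon a _); apply: val_inj.
  - by move: c1; congr (mon c _ = mon a _); apply: val_inj.
  - by move: c2; congr (mon c _ = mon a _); apply: val_inj.
apply: scalemx_sub.
have le_U : (U_(0%R) <= mon a)%MM.
  by apply/mnm_lepP=> l; rewrite mnm1E; case: eqP => [<-|//]; rewrite lt0n.
have def_a : mon a = (U_(0%R) + (mon a - U_(0%R)))%MM by rewrite addmC submK.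
have deg' : mdeg (mon a - U_(0%R))%MM = i.-1.
  by move: deg_a; rewrite {1}def_a mdegD mdeg1; lia.
rewrite def_a mpolyXD -(@coords_mult _ _ _ i.-1) ?submxMl //.
by rewrite dhomogX; apply/eqP.
Qed.

(** The degree i part of the ideal of B/xB in k[y,z], where B is the algebra
    whose ideal in degree i is the kernel of Cat_f(i,j). *)
Definition restr_ann N f i j := kermx (cat_mx f i j) *m restr_mx N i.

(** With c_i the Hilbert function of B/xB, both [i.+1 - \rank (restr_ann ..)]
    and the drop of rank from Cat_f to its rows that are multiples of x
    compute c_i. *)
Lemma rank_restr_ann N f i j : (i < N)%N ->
  (\rank (restr_ann N f i j) + cat_rank f i j =
   \rank (mult_mx x i.-1 i *m cat_mx f i j) + i.+1)%N.
Proof.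
move=> lt_iN; set X := mult_mx x i.-1 i; set C := cat_mx f i j.
have eqX : (X :=: kermx (restr_mx N i))%MS.
  by apply/eqmxP; rewrite ker_restr // andbT; apply/sub_kermxP/mult_x_restr.
have rkX : (2 * \rank X = i.+1 * i)%N.
  rewrite /X; case: (i) => [|i'] /=.
    by rewrite mult_x00 mxrank0.
  have /eqP -> := mult_mx_free (X_neq0 0) (X_homog k 0) (erefl (1 + i')%N).
  by rewrite form_dim3.
have := mxrank_mul_ker (kermx C) (restr_mx N i).
have := mxrank_mul_ker X C; rewrite mxrank_ker.
rewrite (capmxC X) (cap_eqmx (eqmx_refl (kermx C)) eqX) -/(restr_ann N f i j).
have := form_dim3 i; have := rank_leq_row C; rewrite /cat_rank -/C; lia.
Qed.

(** Multiplication by y maps the ideal of B/xB into itself. *)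
Lemma restr_ann_mono N f i j :
  (restr_ann N f i j.+1 <= restr_ann N f i.+1 j)%MS.
Proof.
rewrite /restr_ann -(mult_y_restr N i) mulmxA submxMr //; apply/sub_kermxP.
rewrite -mulmxA (mult_cat_mx _ _ _ (X_homog k 1)) //.
rewrite -(cat_mult_mx _ _ _ (X_homog k 1) (erefl (1 + j)%N)).
by rewrite mulmxA mulmx_ker mul0mx.
Qed.

(** Multiplication by z maps the ideal of B/xB into itself. *)
Lemma restr_ann_shift N f i j :
  (restr_ann N f i j.+1 *m shift N <= restr_ann N f i.+1 j)%MS.
Proof.
rewrite /restr_ann -mulmxA -(mult_z_restr N i) mulmxA submxMr //.
apply/sub_kermxP; rewrite -mulmxA (mult_cat_mx _ _ _ (X_homog k 2%:R)) //.
rewrite -(cat_mult_mx _ _ _ (X_homog k 2%:R) (erefl (1 + j)%N)).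
by rewrite mulmxA mulmx_ker mul0mx.
Qed.

(** If every row is a combination of shifted rows, the first column vanishes,
    hence the second one, and so on. *)
Lemma shift_stable_eq0 N r (A : 'M[k]_(r, N)) :
  (A <= A *m shift N)%MS -> A = 0.
Proof.
case/submxP=> W defA.
suff A0 b (lt_b : (b < N)%N) a : A a (Ordinal lt_b) = 0.
  by apply/matrixP=> a [b lt_b]; rewrite A0 mxE.
elim: b lt_b a => [|b IHb] lt_b a; rewrite defA mulmxA mxE big1 // => c _.
  by rewrite [shift N _ _]mxE mulr0.
rewrite [shift N _ _]mxE eqSS; case: eqP => [eq_cb|]; last by rewrite mulr0.
rewrite mxE big1 ?mul0r // => d _.
have lt_b' : (b < N)%N by rewrite ltnW.
by rewrite (_ : c = Ordinal lt_b') ?IHb ?mulr0 //; apply: val_inj.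
Qed.

(** A nonzero finite dimensional space J of polynomials in T is not stable
    under multiplication by T, so J + T J is strictly larger.  This is why the
    Hilbert function of a quotient of k[y,z] stops growing once the ideal is
    nonzero. *)
Lemma rank_restr_ann_lt N f i j : (i.+1 < N)%N -> restr_ann N f i j.+1 != 0 ->
  (\rank (restr_ann N f i j.+1) < \rank (restr_ann N f i.+1 j))%N.
Proof.
move=> lt_iN; apply: contra_neqT; rewrite -leqNgt => le_rank.
set J := restr_ann N f i j.+1 in le_rank *.
have J'J : (restr_ann N f i.+1 j <= J)%MS.
  have sJJ' := restr_ann_mono N f i j.
  by rewrite -(mxrank_leqif_sup sJJ') // eqn_leq le_rank mxrankS.
have JsJ : (J *m shift N <= J)%MS := submx_trans (restr_ann_shift N f i j) J'J.
apply: shift_stable_eq0; rewrite -(mxrank_leqif_sup JsJ) eqn_leq mxrankS //=.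
have {1}<- : J *m shift N *m (shift N)^T = J.
  rewrite /J /restr_ann -2!mulmxA [restr_mx _ _ *m (_ *m _)]mulmxA.
  by rewrite restr_mx_shiftK.
exact: mxrankM_maxl.
Qed.

Lemma rank_restr_ann_le N f i j q :
  (\rank (restr_ann N f i (j + q)) <= \rank (restr_ann N f (i + q) j))%N.
Proof.
elim: q i => [|q IHq] i; first by rewrite !addn0.
by rewrite addnS (leq_trans (mxrankS (restr_ann_mono _ _ _ _))) // addnS -addSn.
Qed.

(** In the increment from degree i to degree i + 1, the part that comes from
    B/xB can be evaluated at i or, by symmetry, at j; it is nonnegative at i
    while B/xB has no relations, and at j once it has some. *)
Lemma cat_rank_unimodal f i j : (i <= j)%N ->
  (cat_rank f i j.+1 <= cat_rank f i.+1 j)%N.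
Proof.
move: {-1}(i + j)%N (erefl (i + j)%N) => d.
elim: d f i j => [|d IHd] f i j def_d.
  by have [-> ->] : i = 0%N /\ j = 0%N by [lia]; rewrite cat_rankC.
rewrite leq_eqVlt => /predU1P[-> | lt_ij]; first by rewrite cat_rankC.
pose N := (i + j).+3.
(* rho is the Hilbert function, at i' - 1, of the algebra with f x for f. *)
pose rho i' j' := \rank (mult_mx x i'.-1 i' *m cat_mx f i' j').
have rhoE i' j' : rho i'.+1 j' = cat_rank (f * x) i' j'.
  by rewrite /rho (mult_cat_mx _ _ _ (X_homog k 0)).
have rk i' j' : (i' < N)%N ->
    (\rank (restr_ann N f i' j') + cat_rank f i' j' = rho i' j' + i'.+1)%N.
  exact: rank_restr_ann.
have rho1 : (rho i j.+1 <= rho i.+1 j)%N.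
  rewrite rhoE; case: i lt_ij def_d {N rk} => [|i] lt_ij def_d.
    by rewrite /rho mult_x00 mul0mx mxrank0.
  by rewrite rhoE IHd //; lia.
have rho2 : (rho j.+1 i <= rho j i.+1)%N.
  rewrite rhoE; case: j lt_ij def_d {N rk rho1} => [//|j] lt_ij def_d.
  rewrite rhoE cat_rankC [leqRHS]cat_rankC IHd //; lia.
(* If B/xB has no relation in degree i + 1, then c grows from i to i + 1. *)
have [J0 | nzJ] := eqVneq (\rank (restr_ann N f i.+1 j)) 0%N.
  have := rk i j.+1; have := rk i.+1 j; rewrite J0 /N; lia.
(* Otherwise c does not grow from j to j + 1; use the symmetric increment. *)
have lt_J : (\rank (restr_ann N f j i.+1) < \rank (restr_ann N f j.+1 i))%N.
  apply: rank_restr_ann_lt; first by rewrite /N; lia.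
  have := rank_restr_ann_le N f i.+1 i.+1 (j - i.+1); rewrite subnKC //.
  by rewrite -mxrank_eq0; lia.
rewrite cat_rankC [leqRHS]cat_rankC.
have := rk j i.+1; have := rk j.+1 i; move: lt_J; rewrite /N; lia.
Qed.

End Unimodality.

(** By symmetry, unimodality compares any two degrees by their distance to the
    middle; the hypotheses say that a lies between i and j. *)
Lemma cat_rank_le_central (k : fieldType) (phi : {scalar {mpoly k[3]}})
    f i j a b :
  (i + j = a + b)%N -> (i <= a)%N -> (i <= b)%N ->
  (cat_rank phi f i j <= cat_rank phi f a b)%N.
Proof.
wlog le_ab : a b / (a <= b)%N => [wlog_le | ].
  move=> eq_d le_a le_b; have [le_ab | /ltnW le_ba] := leqP a b.
    exact: wlog_le.
  by rewrite [leqRHS]cat_rankC wlog_le // eq_d addnC.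
move=> eq_d le_a _; rewrite -(subnKC le_a).
have {eq_d} -> : (j = b + (a - i))%N by lia.
have: (i + (a - i) <= b)%N by lia.
elim: (a - i)%N b {le_ab} => [|q IHq] b le_b; first by rewrite !addn0.
rewrite addnS -addSn (leq_trans (IHq _ _)) //; first by lia.
by rewrite addnS cat_rank_unimodal //; lia.
Qed.

(** * Homogeneous multiples and top forms *)
Section TopForm.
Variables (k : fieldType) (n : nat).
Implicit Types (f g q : {mpoly k[n]}).

Lemma dhomog_msize_le f d : f \is d.-homog -> (msize f <= d.+1)%N.
Proof.
move/dhomogP=> hom_f; rewrite msizeE; apply/bigmax_leqP_seq => m m_f _.
by rewrite (hom_f m m_f).
Qed.

Definition top_form f := pihomog mdeg (msize f).-1 f.

Lemma top_form_homog f : top_form f \is (msize f).-1.-homog.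
Proof. exact: pihomogP. Qed.

Lemma pihomogM_top q f a b : (msize q <= a.+1)%N -> (msize f <= b.+1)%N ->
  pihomog mdeg (a + b) (q * f) = pihomog mdeg a q * pihomog mdeg b f.
Proof.
move=> le_q le_f.
rewrite {1}(pihomog_partitionE (mf := mdeg) le_q).
rewrite {1}(pihomog_partitionE (mf := mdeg) le_f).
have lower (c c' : nat) : (c + c' < a + b)%N ->
    pihomog mdeg (a + b) (pihomog mdeg c q * pihomog mdeg c' f) = 0.
  move=> lt_c.
  apply: (pihomog_ne0 _ (dhomogM (pihomogP _ _ _) (pihomogP _ _ _))).
  by rewrite neq_ltn lt_c.
rewrite big_distrlr linear_sum big_ord_recr /=.
rewrite big1 ?add0r => [|c _]; last first.
  rewrite linear_sum big1 // => c' _; apply: lower.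
  by have := ltn_ord c; have := ltn_ord c'; lia.
rewrite linear_sum big_ord_recr /= big1 ?add0r => [|c' _]; last first.
  by apply: lower; rewrite ltn_add2l.
by rewrite pihomog_dE // dhomogM ?pihomogP.
Qed.

(** A common divisor need not be known to be homogeneous: in a product that is
    a form, the top forms of the factors already multiply to that form. *)
Lemma homog_top_factor g q f d : g != 0 -> g \is d.-homog -> g = q * f ->
  ((msize f).-1 <= d)%N /\
  g = top_form f * pihomog mdeg (d - (msize f).-1) q.
Proof.
move=> nz_g hom_g def_g.
have nz_q : q != 0 by apply: contraNneq nz_g => q0; rewrite def_g q0 mul0r.
have nz_f : f != 0 by apply: contraNneq nz_g => f0; rewrite def_g f0 mulr0.
have sz_g : msize g = d.+1.
  have := dhomog_uniq nz_g hom_g (dhomog_msize hom_g).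
  by move: nz_g; rewrite -msize_poly_eq0 => nz_g ->; rewrite prednK // lt0n.
have := msizeM nz_q nz_f; rewrite -def_g sz_g.
move: nz_q nz_f; rewrite -!msize_poly_eq0 -!lt0n.
rewrite /top_form; move def_a: (msize q) => a; move def_b: (msize f) => b.
move=> a_gt0 b_gt0 eq_d; have le_d : (b.-1 <= d)%N by lia.
split=> //; rewrite -{1}(pihomog_dE hom_g) def_g mulrC -{1}(subnKC le_d).
by rewrite pihomogM_top ?def_a ?def_b //; lia.
Qed.

End TopForm.

(** * The socle functional of a Gorenstein quotient *)
Section QuotientRank.
Variables (k : fieldType) (n : nat) (I : idealr {mpoly k[n.+1]}).
Implicit Types (f g : {mpoly k[n.+1]}) (i j d : nat).

Lemma pi_ideal_eq0 f : (\pi_{ideal_quot I} f == 0) = (f \in I).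
Proof. by rewrite -[f in RHS]subr0 Quotient.idealrBE pi_zeror. Qed.

(** If the kernel of C is the degree i part of I, then S_i / I_i is the row
    space of C. *)
Lemma quot_degree_rank i m r (C : 'M[k]_(form_dim n i, r)) :
    (forall f, f \is i.-homog -> (f \in I) = (coords i f *m C == 0)) ->
  has_dim (@quot_degree k n.+1 I i) m -> m = \rank C.
Proof.
move=> memI [b [b_deg b_free b_span]].
have [g g_hom b_g] := fin_all_exists2 b_deg.
pose A : 'M[k]_(m, form_dim n i) := \matrix_a coords i (g a).
have pi_comb (c : 'I_m -> k) :
    \pi_{ideal_quot I} (\sum_a c a *: g a) = \sum_a c a *: b a.
  rewrite raddf_sum; apply: eq_bigr => a _; rewrite b_g; exact: pi_scale.
have comb_hom (c : 'I_m -> k) : \sum_a c a *: g a \is i.-homog.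
  by rewrite rpred_sum // => a _; rewrite rpredZ.
have coords_comb (c : 'I_m -> k) :
    coords i (\sum_a c a *: g a) = (\row_a c a) *m A.
  rewrite linear_sum mulmx_sum_row.
  by apply: eq_bigr => a _; rewrite linearZ rowK mxE.
have freeAC : row_free (A *m C).
  apply/inj_row_free => c cAC0; apply/rowP=> a; rewrite [RHS]mxE.
  apply: (b_free (c 0)); apply/eqP; rewrite -pi_comb pi_ideal_eq0 memI //.
  rewrite coords_comb (_ : \row_a _ = c) -?mulmxA ?cAC0 //.
  by apply/rowP=> a'; rewrite mxE.
apply/eqP; rewrite -{1}(eqP freeAC) eqn_leq mxrankM_maxr mxrankS //.
apply/row_subP => a.
have hom_a := Xmon_homog k a.
have [|c def_a] := b_span (\pi_{ideal_quot I} 'X_[mon a]).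
  by exists 'X_[mon a].
have : 'X_[mon a] - \sum_a c a *: g a \in I.
  by rewrite -pi_ideal_eq0 raddfB /= def_a pi_comb subrr.
rewrite memI ?rpredB // linearB /= mulmxBl subr_eq0 coords_comb => /eqP eq_a.
suff -> : row a C = coords i 'X_[mon a] *m C.
  by rewrite eq_a -mulmxA submxMl.
rewrite rowE; congr (_ *m _); apply/rowP=> a'.
by rewrite !mxE mcoeffX (inj_eq (@mon_inj _ _)) eq_sym.
Qed.

Definition form_comb d (c : 'I_(form_dim n d) -> k) f : k :=
  \sum_a f@_(mon a) * c a.

Lemma form_comb_is_linear d (c : 'I_(form_dim n d) -> k) : scalar (form_comb c).
Proof.
move=> u f g; rewrite /form_comb mulr_sumr -big_split; apply: eq_bigr => a _.
by rewrite mcoeffD mcoeffZ mulrDl mulrA.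
Qed.

HB.instance Definition _ d (c : 'I_(form_dim n d) -> k) :=
  GRing.isLinear.Build k {mpoly k[n.+1]} k _ (form_comb c)
    (@form_comb_is_linear d c).

Hypothesis I_homog : homogeneous_ideal I.

Lemma homog_sub_mem i d f g : i != d -> f \is i.-homog -> g \is d.-homog ->
  f - g \in I -> f \in I.
Proof.
move=> ne_id hom_f hom_g /I_homog - /(_ i); rewrite pihomogB pihomog_dE //.
by rewrite (pihomog_ne0 _ hom_g) ?subr0 // eq_sym.
Qed.

Variables (d : nat) (w : {mpoly k[n.+1]}).
Hypotheses (R_gor : gorenstein_quot I) (w_hom : w \is d.-homog).
Hypotheses (w_notin : w \notin I).
Hypothesis I_large : forall i f, (d < i)%N -> f \is i.-homog -> f \in I.

(** The socle is one dimensional and contains the class of w, which has top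
    degree; so the class of an element killed by the variables is a multiple
    of that of w. *)
Lemma socle_line f : (forall l, 'X_l * f \in I) -> exists c, f - c *: w \in I.
Proof.
have socleP g : (forall l, 'X_l * g \in I) -> socle (\pi_{ideal_quot I} g).
  move=> Xg f' [q ->]; apply/eqP; rewrite -rmorphM pi_ideal_eq0 mulr_suml.
  by rewrite rpred_sum // => l _; rewrite -mulrA idealMr.
have w_soc : socle (\pi_{ideal_quot I} w).
  apply: socleP => l; apply: (I_large (ltnSn d)).
  exact: XM_homog.
move=> /socleP f_soc; have [b [_ _ b_span]] := R_gor.
have [[cf def_f] [cw def_w]] := (b_span _ f_soc, b_span _ w_soc).
move: def_f def_w; rewrite !big_ord1; set u := b ord0; move=> def_f def_w.
have cw_nz : cw ord0 != 0.
  apply: contraNneq w_notin => cw0.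
  by rewrite -pi_ideal_eq0 def_w cw0 scale0r.
exists (cf ord0 / cw ord0).
by rewrite -pi_ideal_eq0 raddfB /= pi_scale def_f def_w
  scalerA divfK // subrr.
Qed.

(** A nonzero class of degree below d is not in the socle, so some variable
    does not kill it; climbing up to degree d shows that the pairing of R_i
    with R_(d-i) is nondegenerate. *)
Lemma notin_ideal_lift i j f : (i + j = d)%N -> f \is i.-homog -> f \notin I ->
  exists b : 'I_(form_dim n j), f * 'X_[mon b] \notin I.
Proof.
elim: j i f => [|j IHj] i f.
  move=> _ _ fI; have [b b0] := @mon_surj n 0 0%MM mdeg0.
  by exists b; rewrite -b0 mpolyX0 mulr1.
move=> def_d hom_f fI.
have /existsP[l XfI] : [exists l, 'X_l * f \notin I].
  apply: contraNT fI; rewrite negb_exists => /forallP XfI.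
  have [l|c] := @socle_line f; first by rewrite -[_ \in _]negbK.
  by apply: (homog_sub_mem _ hom_f (rpredZ c w_hom)); lia.
have [||b bI] := IHj i.+1 ('X_l * f) _ _ XfI; first by lia.
  exact: XM_homog.
have [b' def_b'] :
    exists b' : 'I_(form_dim n j.+1), (U_(l) + mon b)%MM = mon b'.
  by apply: mon_surj; rewrite mdegD mdeg1 mdeg_mon.
by exists b'; rewrite -def_b' mpolyXD mulrA (mulrC f).
Qed.

(** The functional reads off the coordinate along w of a class of degree d. *)
Lemma socle_functional : exists phi : {scalar {mpoly k[n.+1]}},
  forall i j f, (i + j = d)%N -> f \is i.-homog ->
    (f \in I) = (coords i f *m cat_mx phi 1 i j == 0).
Proof.
have line_d g : g \is d.-homog -> exists c, g - c *: w \in I.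
  move=> hom_g; apply: socle_line => l; apply: (I_large (ltnSn d)).
  exact: XM_homog.
have line_mon (a : 'I_(form_dim n d)) : exists c, 'X_[mon a] - c *: w \in I.
  exact/line_d/Xmon_homog.
have [c cP] := fin_all_exists line_mon.
exists (form_comb c); set phi := form_comb c.
have phiP g : g \is d.-homog -> (g \in I) = (phi g == 0).
  move=> hom_g.
  have gI : g - phi g *: w \in I.
    rewrite -{1}(coordsK hom_g) /phi /form_comb scaler_suml -sumrB rpred_sum //.
    move=> a _; rewrite mxE -scalerA -scalerBr -mul_mpolyC.
    exact: idealMr.
  apply/idP/eqP => [g_in | phi0]; last by move: gI; rewrite phi0 scale0r subr0.
  apply: contraNeq w_notin => phi_nz.
  have : phi g *: w \in I by rewrite -(rpredBl _ g_in).
  rewrite -mul_mpolyC => /(idealMr (phi g)^-1%:MP).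
  by rewrite mulrA -mpolyCM mulVf // mpolyC1 mul1r.
move=> i j f def_d hom_f; rewrite coords_cat //.
have hom_fb (b : 'I_(form_dim n j)) : f * 'X_[mon b] \is d.-homog.
  by rewrite -def_d dhomogM ?Xmon_homog.
apply/idP/eqP => [fI | /rowP fphi].
  apply/rowP=> b; rewrite !mxE mul1r; apply/eqP.
  by rewrite -phiP // mulrC idealMr.
apply/contraT => /(notin_ideal_lift def_d hom_f)[b].
rewrite phiP // => /eqP[].
by have := fphi b; rewrite !mxE mul1r.
Qed.

End QuotientRank.

(** * Common factors of the relations *)
Section CommonFactor.
Variables (k : fieldType) (phi : {scalar {mpoly k[3]}}).
Implicit Types (F p q : {mpoly k[3]}) (i j e s t : nat).

Lemma form_dim_lt i j : (i < j)%N -> (form_dim 2 i < form_dim 2 j)%N.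
Proof. by move=> lt_ij; have := form_dim3 i; have := form_dim3 j; nia. Qed.

(** Cat_1(s,t) has more rows than columns. *)
Lemma exists_relation s t : (t < s)%N ->
  exists2 p, p != 0 /\ p \is s.-homog & coords s p *m cat_mx phi 1 s t = 0.
Proof.
move=> lt_ts; have /rowV0Pn[v] : kermx (cat_mx phi 1 s t) != 0.
  rewrite kermx_eq0 -row_leq_rank -ltnNge.
  by rewrite (leq_ltn_trans (rank_leq_col _)) ?form_dim_lt.
move=> /sub_kermxP vC nz_v; exists (form_of v); last by rewrite form_ofK.
split; last exact: form_of_homog.
by apply: contraNneq nz_v => v0; rewrite -[v]form_ofK v0 linear0.
Qed.

Lemma rank_common_factor F e i j : F != 0 -> F \is e.-homog -> (e <= i)%N ->
    (forall p, p \is i.-homog -> coords i p *m cat_mx phi 1 i j = 0 ->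
       exists2 q, q \is (i - e).-homog & p = F * q) ->
  (form_dim 2 i + cat_rank phi F (i - e) j =
   cat_rank phi 1 i j + form_dim 2 (i - e))%N.
Proof.
move=> nz_F hom_F le_ei factor.
have def_i := esym (subnKC le_ei).
set X := mult_mx F (i - e) i; set C := cat_mx phi 1 i j.
have kerC : (kermx C <= X)%MS.
  apply/rV_subP=> v /sub_kermxP vC.
  have [||q hom_q def_v] := factor (form_of v);
    rewrite ?form_ofK ?form_of_homog //.
  by rewrite -[v]form_ofK def_v -(coords_mult _ _ hom_q) submxMl.
have := mxrank_mul_ker X C.
rewrite (mult_cat_mx _ 1 _ hom_F def_i) mul1r (capmx_idPr kerC) mxrank_ker.
have /eqP-> := mult_mx_free nz_F hom_F def_i.
by have := rank_leq_row C; rewrite /cat_rank -/C; lia.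
Qed.

(** Strict convexity of the dimensions of the spaces of forms against
    unimodality of the ranks of Cat_F.  When t < e the relations of degree t
    vanish, and the dimension count alone excludes e > 0. *)
Lemma common_factor_const F e s t : F != 0 -> F \is e.-homog -> (t < s)%N ->
    (forall i j p, (i + j = s + t)%N -> (i <= s)%N ->
       p != 0 -> p \is i.-homog -> coords i p *m cat_mx phi 1 i j = 0 ->
       (e <= i)%N /\ exists2 q, q \is (i - e).-homog & p = F * q) ->
  e = 0%N.
Proof.
move=> nz_F hom_F lt_ts factor.
have factor0 i j : (i + j = s + t)%N -> (i <= s)%N ->
    forall p, p \is i.-homog -> coords i p *m cat_mx phi 1 i j = 0 ->
    exists2 q, q \is (i - e).-homog & p = F * q.
  move=> eq_d le_is p hom_p pC; have [->|nz_p] := eqVneq p 0.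
    by exists 0; rewrite ?mulr0 ?dhomog0.
  by case: (factor i j p).
have le_es : (e <= s)%N.
  have [p [nz_p hom_p] pC] := exists_relation lt_ts.
  by case: (factor s t p).
have := rank_common_factor nz_F hom_F le_es (factor0 s t erefl (leqnn s)).
have dim_s := form_dim3 s; have dim_t := form_dim3 t.
have := form_dim3 (s - e).
have [le_et | lt_te] := leqP e t.
  have factor_t := factor0 t s (addnC _ _) (ltnW lt_ts).
  have := rank_common_factor nz_F hom_F le_et factor_t.
  have := form_dim3 (t - e).
  have : (cat_rank phi F (t - e) s <= cat_rank phi F (s - e) t)%N.
    by rewrite [leqRHS]cat_rankC cat_rank_le_central //; lia.
  rewrite (cat_rankC _ _ t s).
  have [u def_s] : exists u, s = (e + u)%N by exists (s - e)%N; lia.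
  have [v def_t] : exists v, t = (e + v)%N by exists (t - e)%N; lia.
  by move: lt_ts dim_s dim_t; rewrite def_s def_t !addKn; nia.
have : cat_rank phi 1 s t = form_dim 2 t.
  rewrite cat_rankC; apply/eqP; rewrite -[_ == _]/(row_free _) -kermx_eq0.
  apply/rowV0P=> v /sub_kermxP vC; apply: contraTeq lt_te => nz_v.
  have [|||||//] := factor t s (form_of v); rewrite ?form_ofK ?form_of_homog //.
  - by rewrite addnC.
  - exact: ltnW.
  - by apply: contraNneq nz_v => v0; rewrite -[v]form_ofK v0 linear0.
  by rewrite -leqNgt.
move=> ->; have [u def_s] : exists u, s = (e + u)%N by exists (s - e)%N; lia.
by move: dim_s dim_t; rewrite def_s !addKn; nia.
Qed.
End CommonFactor.

(** * From the h-vector to the theorem *)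
Section HasDim.
Variables (k : fieldType) (V : lmodType k) (W : V -> Prop).

Lemma has_dim0 v : has_dim W 0 -> W v -> v = 0.
Proof. by case=> b [_ _ b_span] /b_span[c ->]; rewrite big_ord0. Qed.

Lemma has_dim_gt0 m : has_dim W m -> (0 < m)%N -> exists2 v, W v & v != 0.
Proof.
case=> b [Wb b_free _] m_gt0; pose a := Ordinal m_gt0.
exists (b a) => //; apply/eqP=> ba0; have /eqP[] := oner_neq0 k.
have := b_free (fun a' => (a == a')%:R) _ a; rewrite eqxx; apply.
rewrite (bigD1 a) //= ba0 scaler0 add0r big1 // => a' ne.
by rewrite eq_sym (negbTE ne) scale0r.
Qed.
End HasDim.

Lemma last_peakP h : (first_peak h < last_peak h)%N ->
  [/\ (last_peak h < size h)%N, nth 0%N h (first_peak h) = peak_value h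
    & forall i, (i < size h)%N -> nth 0%N h i = peak_value h ->
        (i <= last_peak h)%N].
Proof.
move=> lt_fl.
have lt_l : (last_peak h < size h)%N.
  have h_gt0 : (0 < size h)%N.
    by case: (h) lt_fl => // ; rewrite /last_peak big_ord0.
  apply: (big_ind (fun m => (m < size h)%N)) => // a b.
  by rewrite gtn_max => -> ->.
split=> //; last first.
  move=> i lt_i hi.
  by rewrite /last_peak (bigD1 (Ordinal lt_i)) /= ?hi ?leq_maxl.
by apply: nth_index; rewrite -index_mem (ltn_trans lt_fl).
Qed.

Unset Implicit Arguments.

Theorem theorem5p4 (k : fieldType) (I : idealr {mpoly k[3]}) (h : seq nat)
  (I_homog : homogeneous_ideal I)
  (I_sub_m : forall f, f \in I -> irrelevant f)
  (R_artinian : artinian_quot I)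
  (R_gorenstein : gorenstein_quot I)
  (h_hvector : is_hvector I h)
  (R_codim3 : nth 0%N h 1 = 3%N)
  (R_peaks : (2 <= num_peaks h)%N) :
  is_gcd (ideal_le I (last_peak h)) 1.
Proof.
have [last_nz h_dim] := h_hvector.
have lt_fl : (first_peak h < last_peak h)%N.
  by move: R_peaks; rewrite /num_peaks; lia.
have [lt_l h_first le_last] := last_peakP lt_fl.
pose d := (size h).-1; set s := last_peak h in lt_fl lt_l le_last *.
have [v [w w_hom def_v] nz_v] : exists2 v, @quot_degree k 3 I d v & v != 0.
  by apply: has_dim_gt0 (h_dim d) _; rewrite nth_last lt0n.
have w_notin : w \notin I by rewrite -pi_ideal_eq0 -def_v.
have I_large i f : (d < i)%N -> f \is i.-homog -> f \in I.
  move=> lt_di hom_f; rewrite -pi_ideal_eq0; apply/eqP.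
  have := h_dim i; rewrite nth_default => [dim0 | ]; last first.
    by rewrite /d in lt_di *; lia.
  by apply: (has_dim0 dim0); exists f.
have [phi memI] := socle_functional I_homog R_gorenstein w_hom w_notin I_large.
have h_rank i j : (i + j = d)%N -> nth 0%N h i = cat_rank phi 1 i j.
  move=> def_d; apply: (quot_degree_rank _ (h_dim i)) => f; exact: memI.
(* By symmetry of h the mirror image of the first peak is a peak as well. *)
have [t def_d] : exists t, (s + t = d)%N by exists (d - s)%N; rewrite /d; lia.
have lt_ts : (t < s)%N.
  have := le_last (d - first_peak h)%N.
  have le_fd : (first_peak h <= d)%N by rewrite /d; lia.
  rewrite (h_rank _ _ (subnK le_fd)) cat_rankC -h_rank ?subnKC // h_first.
  by rewrite /d in le_fd def_d *; lia.
split=> [f _ | f f_div]; first by exists f; rewrite mulr1.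
have f_div_homog i j p : (i + j = s + t)%N -> (i <= s)%N -> p != 0 ->
    p \is i.-homog -> coords i p *m cat_mx phi 1 i j = 0 ->
  ((msize f).-1 <= i)%N /\
  exists2 q, q \is (i - (msize f).-1).-homog & p = top_form f * q.
  rewrite def_d => eq_d le_is nz_p hom_p /eqP; rewrite -memI // => pI.
  have [|q def_p] := f_div p.
    by split=> //; apply: leq_trans (dhomog_msize_le hom_p) _.
  have [le_f ->] := homog_top_factor nz_p hom_p def_p.
  split=> //; exists (pihomog mdeg (i - (msize f).-1) q) => //.
  exact: pihomogP.
have nz_top : top_form f != 0.
  have [p [nz_p hom_p] pC] := exists_relation phi lt_ts.
  have [_ [q _ def_p]] := f_div_homog s t p erefl (leqnn s) nz_p hom_p pC.
  by apply: contraNneq nz_p => F0; rewrite def_p F0 mul0r.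
have deg_f := common_factor_const nz_top (top_form_homog f) lt_ts f_div_homog.
have def_f : f = (f@_0)%:MP.
  by apply: msize1_polyC; move: deg_f; case: (msize f) => [|[]].
have nz_f : f@_0 != 0.
  apply: contraNneq nz_top => f0.
  by rewrite def_f f0 /top_form mpolyC0 pihomog0.
by exists (f@_0)^-1%:MP; rewrite {2}def_f -mpolyCM mulVf // mpolyC1.
Qed.
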